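(* Let $f:\mathbb{R}^n\to\mathbb{R}$ belong to the class $C^1_{L_1}$, let $x^*$ be a minimizer of $f$, and let the random sequence $\{x_k\}_{k\ge0}$ be generated from a starting point $x_0\in\mathbb{R}^n$ by Random Pursuit $\mathcal{RP}_\mu$ with absolute line search accuracy $\mu\ge 0$. Assume there exists $R\in\mathbb{R}$ such that $\|y-x^*\|<R$ for all $y\in\mathbb{R}^n$ with $f(y)\le f(x_0)$. Then for any integer $N\ge0$, $$\mathbb{E}\left[f(x_N)-f(x^* )\right]\le\frac{Q}{N+1}+\frac{N L_1\mu^2}{2},$$ where $$Q=\max\left\{2nL_1R^2,\ f(x_0)-f(x^* )\right\}.$$
   Context: Norms are Euclidean and $\langle\cdot,\cdot\rangle$ is the standard inner product on $\mathbb{R}^n$; $S^{n-1}=\{y\in\mathbb{R}^n:\|y\|=1\}$. Class $C^1_{L_1}$ ($L_1>0$): differentiable convex functions $f:\mathbb{R}^n\to\mathbb{R}$ with $f(y)-f(x)-\langle\nabla f(x),y-x\rangle\le\frac{L_1}{2}\|x-y\|^2$ for all $x,y\in\mathbb{R}^n$. Exact line search oracle: a function $\mathrm{LS}:\mathbb{R}^n\times S^{n-1}\to\mathbb{R}$ with $\mathrm{LS}(x,u)\in\arg\min_{h\in\mathbb{R}}f(x+hu)$ (the argmin need not be unique; LS selects one element). Such an oracle is assumed to exist for $f$. Given such LS, an absolute approximate line search oracle with accuracy $\mu\ge0$ is a function $\mathrm{LSapprox}^{\mathrm{abs}}_\mu:\mathbb{R}^n\times S^{n-1}\to\mathbb{R}$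 with $\mathrm{LS}(x,u)-\mu\le\mathrm{LSapprox}^{\mathrm{abs}}_\mu(x,u)\le\mathrm{LS}(x,u)+\mu$ for all $x,u$. The oracles are taken to be Borel measurable so that expectations are meaningful. Random Pursuit $\mathcal{RP}_\mu$ with absolute line search accuracy $\mu$: starting from a deterministic $x_0\in\mathbb{R}^n$, at each iteration $k=0,1,2,\dots$ a direction $u_k$ is drawn uniformly at random from $S^{n-1}$, independently of the previous draws, and $x_{k+1}:=x_k+\mathrm{LSapprox}^{\mathrm{abs}}_\mu(x_k,u_k)\,u_k$. *)

(* Defs.v *)
From HB Require Import structures.
From mathcomp Require Import all_boot all_order all_algebra.
From mathcomp Require Import all_classical all_reals all_analysis.

Set Implicit Arguments.
Unset Strict Implicit.
Unset Printing Implicit Defensive.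

Import Order.TTheory GRing.Theory Num.Theory.
Import numFieldNormedType.Exports.

Local Open Scope classical_set_scope.
Local Open Scope ring_scope.

(* The library's norm on ['rV[R]_n] is the sup norm, hence [enorm]; the two
   norms induce the same topology, so [differentiable] and [open] are the
   usual notions on Euclidean space. *)
Definition dotprod (R : realType) (n : nat) (x y : 'rV[R]_n) : R :=
  \sum_(i < n) x 0 i * y 0 i.

Definition enorm (R : realType) (n : nat) (x : 'rV[R]_n) : R :=
  Num.sqrt (dotprod x x).

Definition sphere (R : realType) (n : nat) : set 'rV[R]_n :=
  [set u | enorm u = 1].

Definition gradient (R : realType) (n : nat) (f : 'rV[R]_n -> R)
    (x : 'rV[R]_n) : 'rV[R]_n :=
  \row_(i < n) 'D_(delta_mx 0 i) f x.

Definition smooth_convex (R : realType) (n : nat) (L1 : R)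
    (f : 'rV[R]_n -> R) : Prop :=
  [/\ forall x, differentiable f x,
      convex_function setT f
    & forall x y, f y - f x - dotprod (gradient f x) (y - x)
                  <= L1 / 2 * enorm (x - y) ^+ 2].

Notation borel_rV R n := (g_sigma_algebraType (open : set (set 'rV[R]_n))).

(* Oracles are total in the direction, but are constrained only on unit
   directions: their values elsewhere are never used. *)
Definition exact_line_search (R : realType) (n : nat) (f : 'rV[R]_n -> R)
    (LS : 'rV[R]_n -> 'rV[R]_n -> R) : Prop :=
  forall x u, sphere u -> forall h : R, f (x + LS x u *: u) <= f (x + h *: u).

Definition abs_approx_line_search (R : realType) (n : nat) (mu : R)
    (LS LSapprox : 'rV[R]_n -> 'rV[R]_n -> R) : Prop :=
  forall x u, sphere u -> LS x u - mu <= LSapprox x u <= LS x u + mu.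

Definition measurable_oracle (R : realType) (n : nat)
    (LS : 'rV[R]_n -> 'rV[R]_n -> R) : Prop :=
  measurable_fun
    ([set: borel_rV R n] `*` (@sphere R n : set (borel_rV R n)))
    (fun p : borel_rV R n * borel_rV R n => LS p.1 p.2).

(* The uniform distribution on the sphere is the (unique) Borel probability
   measure carried by the sphere and invariant under the orthogonal group. *)
Definition uniform_on_sphere (R : realType) (n : nat)
    (m : probability (borel_rV R n) R) : Prop :=
  m (@sphere R n) = 1%E /\
  forall Q : 'M[R]_n, Q *m Q^T = 1%:M ->
  forall A : set (borel_rV R n), measurable A ->
    m ((fun v : 'rV[R]_n => v *m Q) @^-1` A) = m A.

Definition mutually_independent (d d' : measure_display) (T : measurableType d)
    (T' : measurableType d') (R : realType) (P : probability T R)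
    (X : nat -> {RV P >-> T'}) : Prop :=
  forall (J : seq nat) (A : nat -> set T'), uniq J ->
    (forall j, measurable (A j)) ->
    P (\bigcap_(j in [set` J]) (X j @^-1` A j)) =
    \big[*%E/1%E]_(j <- J) P (X j @^-1` A j).

Definition uniform_directions (d : measure_display) (T : measurableType d) (R : realType)
    (P : probability T R) (n : nat) (u : nat -> {RV P >-> borel_rV R n}) :=
  [/\ forall k w, @sphere R n (u k w),
      forall k, uniform_on_sphere (distribution P (u k))
    & mutually_independent u].

Fixpoint random_pursuit (R : realType) (n : nat)
    (LSapprox : 'rV[R]_n -> 'rV[R]_n -> R) (x0 : 'rV[R]_n)
    (u : nat -> 'rV[R]_n) (k : nat) : 'rV[R]_n :=
  if k is k'.+1 then
    let x := random_pursuit LSapprox x0 u k' in x + LSapprox x (u k') *: u k'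
  else x0.

(* Main.v *)
Require Import Defs.
From HB Require Import structures.
From mathcomp Require Import all_boot all_order all_algebra.
From mathcomp Require Import ring lra.
From mathcomp Require Import all_classical all_reals all_analysis.
From mathcomp Require Import measurable_realfun.

(** Write [g] for the gradient at the current iterate [x], [u] for the direction
    drawn there, [e = L1 mu ^ 2 / 2], and [D k] for the gap [f (x k) - f xs].

    An exact line search along [u] lowers [f] by at least [<g, u> ^ 2 / (2 L1)],
    and the inaccuracy of the oracle costs at most [e] ([descent_step]).  The
    direction is independent of the iterate ([iterate_indep_future]) and isotropic
    ([uniform_second_moment]), so the expected squared slope is [|g| ^ 2 / n].  By
    convexity [D k <= |g| |x - xs|], which would give the classical recursion
    [E D (k + 1) <= E D k - (E D k) ^ 2 / (2 n L1 r ^ 2) + e] if all the iterates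
    remained at distance less than [r] from [xs].

    They need not: with [mu > 0] an iterate can leave the initial level set.  Two
    observations repair this.  The compensated gap [D k - k e] never increases
    along a trajectory, so it is at most [f x0 - f xs]; and, by convexity, the
    gradient outside a level set is at least as steep as the bound valid on its
    boundary.  Hence [r |g| >= D k - k e] holds everywhere
    ([level_set_gradient_lb]), and the compensated expected gap
    [s k = E D k - k e] satisfies
    [s (k + 1) <= s k - (2 c s k - c ^ 2) / (2 n L1 r ^ 2)] for every [c >= 0]
    ([expected_step]).  Choosing [c] of order [1 / k] gives [s N <= Q / (N + 1)]
    ([recursion_bound]). *)

Set Implicit Arguments.
Unset Strict Implicit.
Unset Printing Implicit Defensive.

Import Order.TTheory GRing.Theory Num.Theory.
Import numFieldNormedType.Exports.

Local Open Scope classical_set_scope.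
Local Open Scope ring_scope.

(** * Euclidean inner product *)

Lemma dotprodC (R : realType) (n : nat) (x y : 'rV[R]_n) :
  dotprod x y = dotprod y x.
Proof. by apply: eq_bigr => i _; rewrite mulrC. Qed.

Lemma dotprodDl (R : realType) (n : nat) (x y z : 'rV[R]_n) :
  dotprod (x + y) z = dotprod x z + dotprod y z.
Proof. by rewrite -big_split; apply: eq_bigr => i _; rewrite mxE mulrDl. Qed.

Lemma dotprodZl (R : realType) (n : nat) (t : R) (x y : 'rV[R]_n) :
  dotprod (t *: x) y = t * dotprod x y.
Proof. by rewrite [RHS]mulr_sumr; apply: eq_bigr => i _; rewrite mxE mulrA. Qed.

Lemma dotprodDr (R : realType) (n : nat) (x y z : 'rV[R]_n) :
  dotprod x (y + z) = dotprod x y + dotprod x z.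
Proof. by rewrite dotprodC dotprodDl !(dotprodC x). Qed.

Lemma dotprodZr (R : realType) (n : nat) (t : R) (x y : 'rV[R]_n) :
  dotprod x (t *: y) = t * dotprod x y.
Proof. by rewrite dotprodC dotprodZl dotprodC. Qed.

Lemma dotprod_ge0 (R : realType) (n : nat) (x : 'rV[R]_n) : 0 <= dotprod x x.
Proof. by apply: sumr_ge0 => i _; rewrite -expr2 sqr_ge0. Qed.

Lemma enorm_sqr (R : realType) (n : nat) (x : 'rV[R]_n) :
  enorm x ^+ 2 = dotprod x x.
Proof. by rewrite sqr_sqrtr // dotprod_ge0. Qed.

Lemma sphere_dotprod (R : realType) (n : nat) (u : 'rV[R]_n) :
  sphere u -> dotprod u u = 1.
Proof. by rewrite /sphere /= -enorm_sqr => ->; rewrite expr1n. Qed.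

(** * Deterministic estimates *)

Lemma smooth_ub (R : realType) (n : nat) (L1 : R) (f : 'rV[R]_n -> R)
    (hf : smooth_convex L1 f) (x v : 'rV[R]_n) :
  f (x + v) <= f x + dotprod (gradient f x) v + L1 / 2 * dotprod v v.
Proof.
case: hf => _ _ /(_ x (x + v)).
have -> : x - (x + v) = (- 1) *: v by rewrite scaleN1r opprD addNKr.
have -> : x + v - x = v by rewrite addrC addKr.
rewrite enorm_sqr dotprodZl dotprodZr.
by move=> h; lra.
Qed.

(** Both line-search facts come from the quadratic upper bound alone.  The exact
    minimizer [z] on the line is no worse than the minimizer of the quadratic
    majorant at [x], which gains [<g, u> ^ 2 / (2 L1)].  At [z] the directional
    slope vanishes, since a nonzero slope would let the majorant at [z] go below
    the minimum; so moving by at most [mu] away from [z] costs at most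
    [L1 mu ^ 2 / 2]. *)
Lemma descent_step (R : realType) (n : nat) (L1 : R) (hL1 : 0 < L1)
    (f : 'rV[R]_n -> R) (hf : smooth_convex L1 f) (mu : R)
    (LS LSapprox : 'rV[R]_n -> 'rV[R]_n -> R)
    (hLS : exact_line_search f LS)
    (hLSapprox : abs_approx_line_search mu LS LSapprox)
    (x u : 'rV[R]_n) (hu : sphere u) :
  f (x + LSapprox x u *: u) + dotprod (gradient f x) u ^+ 2 / (2 * L1)
    <= f x + L1 * mu ^+ 2 / 2.
Proof.
have uu := sphere_dotprod hu.
set z := x + LS x u *: u.
have ub y h : f (y + h *: u)
    <= f y + h * dotprod (gradient f y) u + L1 / 2 * h ^+ 2.
  have := smooth_ub hf y (h *: u).
  by rewrite !dotprodZr dotprodZl uu mulr1 expr2.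
have zmin h : f z <= f (z + h *: u).
  by rewrite /z -addrA -scalerDl; exact: hLS.
have completed s : (- (s / L1)) * s + L1 / 2 * (- (s / L1)) ^+ 2
    = - (s ^+ 2 / (2 * L1)).
  by field; rewrite gt_eqF.
have grad0 : dotprod (gradient f z) u = 0.
  set s := dotprod _ _.
  have h1 := zmin (- (s / L1)); have h2 := ub z (- (s / L1)).
  have : s ^+ 2 / (2 * L1) <= 0 by have := completed s; rewrite -/s in h2; lra.
  rewrite pmulr_lle0 ?invr_gt0 ?mulr_gt0 // => s2.
  by apply/eqP; rewrite -sqrf_eq0 eq_le s2 sqr_ge0.
have exact_step : f z + dotprod (gradient f x) u ^+ 2 / (2 * L1) <= f x.
  set s := dotprod _ _.
  have h1 := hLS x u hu (- (s / L1)); have h2 := ub x (- (s / L1)).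
  by have := completed s; rewrite -/s -/z in h1 h2 *; lra.
have : f (x + LSapprox x u *: u) <= f z + L1 * mu ^+ 2 / 2.
  set h := LSapprox x u - LS x u.
  have -> : x + LSapprox x u *: u = z + h *: u.
    by apply/rowP => i; rewrite /z /h !mxE; ring.
  apply: le_trans (ub z h) _; rewrite grad0 mulr0 addr0 lerD2l.
  have : h ^+ 2 <= mu ^+ 2.
    have := hLSapprox x u hu; rewrite /h => /andP[l1 l2].
    by rewrite -subr_ge0 subr_sqr mulr_ge0 //; lra.
  by move=> h2; rewrite mulrAC ler_pM2r ?invr_gt0 // ler_pM2l.
lra.
Qed.

Lemma convex_functionE (R : realType) (n : nat) (f : 'rV[R]_n -> R) :
  convex_function setT f -> forall (t : R) (x y : 'rV[R]_n),
  0 <= t <= 1 -> f (t *: x + (1 - t) *: y) <= t * f x + (1 - t) * f y.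
Proof.
move=> cf t x y /andP[t0 t1].
pose t' : {i01 R} := Itv01 t0 t1.
by have := cf t' x y; rewrite !inE; apply.
Qed.

(** The first-order characterization of convexity, derived without passing to
    difference quotients: [x] is a convex combination of [x + v] and [x - t v],
    and the quadratic majorant controls [f (x - t v)] up to [O(t ^ 2)], so the
    error after dividing by [t] is [O(t)]. *)
Lemma convex_gradient_lb (R : realType) (n : nat) (L1 : R) (hL1 : 0 < L1)
    (f : 'rV[R]_n -> R) (hf : smooth_convex L1 f) (x v : 'rV[R]_n) :
  f x + dotprod (gradient f x) v <= f (x + v).
Proof.
have cvx : convex_function setT f by case: hf.
have v0 := dotprod_ge0 v.
set K := L1 / 2 * dotprod v v.
have K0 : 0 <= K by rewrite mulr_ge0 ?divr_ge0 // ltW.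
rewrite -subr_le0; apply/ler_addgt0Pr => e e0; rewrite add0r.
(* The error left is t * K; K may vanish, hence the denominator K + 1. *)
pose t := e / (K + 1).
have t0 : 0 < t by rewrite divr_gt0 //; lra.
have tK : t * K <= e.
  by rewrite /t mulrAC ler_pdivrMr; last lra; rewrite ler_pM2l //; lra.
have t1 : 0 < 1 + t by lra.
have t1N : 1 + t != 0 by rewrite gt_eqF.
have xE : x = (t / (1 + t)) *: (x + v) + (1 - t / (1 + t)) *: (x - t *: v).
  by apply/rowP => i; rewrite !mxE; field.
have tt : 0 <= t / (1 + t) <= 1.
  by apply/andP; split; [rewrite divr_ge0 // ltW | rewrite ler_pdivrMr //; lra].
have hcvx := convex_functionE cvx (x + v) (x - t *: v) tt.
rewrite -xE in hcvx.
have := smooth_ub hf x (- t *: v).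
rewrite !dotprodZr dotprodZl scaleNr.
set s := dotprod _ v.
have -> : L1 / 2 * (- t * (- t * dotprod v v)) = t * (t * K).
  by rewrite /K; ring.
set a := f x in hcvx *; set b := f (x + v) in hcvx *.
set c := f (x - _) in hcvx * => hub.
have hm : (1 + t) * a <= t * b + c.
  rewrite -(ler_pM2l t1) in hcvx; apply: le_trans hcvx _.
  by rewrite le_eqVlt; apply/orP; left; apply/eqP; field.
rewrite -(ler_pM2l t0); have : t * (t * K) <= t * e by rewrite ler_pM2l.
lra.
Qed.

(** A gradient bound that stays valid outside the level set of height [a].  If
    [f x - f xs <= a], then [f x - f xs <= <g, x - xs>] with [enorm (x - xs) < r].
    Otherwise the point of the segment from [xs] to [x] at ratio
    [a / (f x - f xs)] lies in the level set by convexity, and scaling the same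
    inequality by this ratio still bounds [a], hence [s], by an inner product of
    [g] with a vector of norm less than [r].  So [s <= r |g|]; the conclusion
    bounds [2 c s - c ^ 2], the tangent to [s ^ 2] at [c], because it is linear in
    [s] and expectations can then be taken without Jensen's inequality. *)
Lemma level_set_gradient_lb (R : realType) (n : nat) (L1 : R) (hL1 : 0 < L1)
    (f : 'rV[R]_n -> R) (hf : smooth_convex L1 f)
    (xs : 'rV[R]_n) (hxs : forall y, f xs <= f y) (a r : R)
    (hr : forall y, f y <= f xs + a -> enorm (y - xs) < r)
    (x : 'rV[R]_n) (s c : R) :
  0 <= a -> s <= a -> s <= f x - f xs -> 0 <= c ->
  2 * c * s - c ^+ 2 <= r ^+ 2 * dotprod (gradient f x) (gradient f x).
Proof.
move=> a0 sa sD c0.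
set g := gradient f x; set D := f x - f xs.
have D0 : 0 <= D by rewrite subr_ge0.
have r0 : 0 < r.
  by apply: le_lt_trans (hr xs _); [exact: sqrtr_ge0 | rewrite lerDl].
suff [l [l01 sl lr]] : exists l : R,
    [/\ 0 <= l <= 1, s <= l * D & enorm (l *: (x - xs)) < r].
  have /andP[l0 l1] := l01.
  have Dg : D <= dotprod g (x - xs).
    have := convex_gradient_lb hL1 hf x (xs - x).
    rewrite (_ : x + (xs - x) = xs); last by rewrite addrC subrK.
    by rewrite -opprB -scaleN1r dotprodZr -/g /D; lra.
  set w := l *: _ in lr.
  have wr : dotprod w w <= r ^+ 2.
    by rewrite -enorm_sqr ler_pXn2r ?nnegrE ?sqrtr_ge0 ?ltW.
  have gw : s <= dotprod g w.
    by apply: le_trans sl _; rewrite /w dotprodZr ler_wpM2l.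
  (* Young's inequality for the product of c and <g, w>. *)
  clearbody w; have := dotprod_ge0 (r *: g - (c / r) *: w).
  rewrite -scaleNr !dotprodDl !dotprodDr !dotprodZl !dotprodZr (dotprodC w g).
  move: gw wr; rewrite /=; move: (dotprod w w) (dotprod g w) (dotprod g g).
  move=> ww gw gg gws wwr.
  rewrite [leRHS](_ : _ = r ^+ 2 * gg - 2 * c * gw + c ^+ 2 * (ww / r ^+ 2));
    last by field; rewrite gt_eqF.
  have : c ^+ 2 * (ww / r ^+ 2) <= c ^+ 2.
    by rewrite ler_piMr ?sqr_ge0 // ler_pdivrMr ?exprn_gt0 // mul1r.
  have : c * s <= c * gw by rewrite ler_wpM2l.
  lra.
have [Da|aD] := leP D a.
  exists 1; rewrite mul1r scale1r; split => //; first by rewrite lexx ler01.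
  by apply: hr; rewrite /D in Da; lra.
have Dp : 0 < D by apply: le_lt_trans aD.
have la : 0 <= a / D <= 1.
  by rewrite divr_ge0 //= ler_pdivrMr // mul1r ltW.
exists (a / D); rewrite divfK ?gt_eqF //; split => //.
have -> : (a / D) *: (x - xs)
    = (a / D) *: x + (1 - a / D) *: xs - xs.
  by apply/rowP => i; rewrite !mxE; ring.
apply: hr; have cvx : convex_function setT f by case: hf.
apply: le_trans (convex_functionE cvx x xs la) _.
have : a / D * D = a by rewrite divfK // gt_eqF.
rewrite {2}/D; lra.
Qed.

(** * Borel measurability on the space of row vectors *)

Lemma continuous_measurable_rV (R : realType) (n : nat) (h : 'rV[R]_n -> R) :
  continuous h -> measurable_fun setT (h : borel_rV R n -> R).
Proof.
move=> /continuousP ch; apply: (measurability _ (RGenOpens.measurableE R)).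
move=> _ [_ [a [b ->] <-]]; rewrite setTI; apply: sub_sigma_algebra.
exact/ch/interval_open.
Qed.

Lemma measurable_rV_coord (R : realType) (n : nat) (i : 'I_n) :
  measurable_fun setT (fun v : borel_rV R n => v 0 i).
Proof. by apply: continuous_measurable_rV => v; exact: coord_continuous. Qed.

(** The Borel sigma-algebra of a finite-dimensional space is generated by the
    coordinates: every open set is a countable union of boxes with rational
    centre and radius [1 / (m + 1)].  This makes sums and scalar multiples of
    vector-valued maps measurable. *)
Lemma measurable_fun_rV (d : measure_display) (T : measurableType d)
    (R : realType) (n : nat) (D : set T) (X : T -> borel_rV R n) :
  measurable D ->
  (forall i, measurable_fun D (fun w => X w 0 i)) -> measurable_fun D X.
Proof.
move=> mD mX; apply: (measurability (open : set (set (borel_rV R n)))) => [//|].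
move=> _ [U oU <-].
pose box (p : 'rV[rat]_n * nat) : set 'rV[R]_n :=
  [set v | forall i, `|ratr (p.1 0 i) - v 0 i| < p.2.+1%:R^-1].
pose F p := if `[< box p `<=` U >] then D `&` X @^-1` box p else set0.
have -> : D `&` X @^-1` U = \bigcup_p F p.
  apply/seteqP; split => w /=; last first.
    by case=> p _; rewrite /F; case: asboolP => // pU [Dw Xp]; split => //; exact: pU.
  move=> [Dw Uw]; have /nbhs_ballP[e /= e0 eU] : nbhs (X w) U by exact: open_nbhs_nbhs.
  have [m] : exists m : nat, 2 * m.+1%:R^-1 < e.
    have [m _ /(_ m (leqnn _)) hm] := near_infty_natSinv_lt (PosNum (divr_gt0 e0 (ltr0n R 2))).
    by exists m; move: hm; rewrite /= ltr_pdivlMr // mulrC.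
  have boxE v q : box (q, m) v = forall i, `|ratr (q 0 i) - v 0 i| < m.+1%:R^-1.
    by [].
  have : 0 < m.+1%:R^-1 :> R by [].
  move: (m.+1%:R^-1) boxE => del boxE del0 dele.
  have /choice[q qP] : forall i : 'I_n, exists q : rat,
      `|ratr q - X w 0 i| < del.
    move=> i; have : X w 0 i - del < X w 0 i + del by lra.
    by move=> /rat_in_itvoo[q]; rewrite in_itv /= -ltr_distl => hq; exists q.
  have bw : box (\row_i q i, m) (X w) by rewrite boxE => i; rewrite mxE.
  exists (\row_i q i, m) => //; rewrite /F asboolT; first by split.
  move=> v bv; apply: eU; split => // i j; rewrite ord1 /ball /=.
  rewrite boxE in bv; rewrite boxE in bw.
  have := bv j; have := bw j => h1 h2.
  have := ler_distD (ratr ((\row_i q i) 0 j)) (X w 0 j) (v 0 j).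
  rewrite (distrC (X w 0 j) (ratr _)); lra.
apply: countable_bigcupT_measurable => [|p]; first exact: countableP.
rewrite /F; case: asboolP => // _.
have -> : D `&` X @^-1` box p = D `&` \bigcap_(i in [set: 'I_n])
    (D `&` (fun w => `|ratr (p.1 0 i) - X w 0 i|) @^-1` `]-oo, p.2.+1%:R^-1[).
  apply/seteqP; split => w /= [Dw bw]; split => // i.
    by split => //=; rewrite in_itv /=; exact: bw.
  by have [_ /=] := bw i I; rewrite in_itv.
apply: measurableI => //; apply: fin_bigcap_measurable => // i _.
have mi : measurable_fun D (fun w => `|ratr (p.1 0 i) - X w 0 i|).
  apply: measurableT_comp; first exact: normr_measurable.
  by apply: measurable_funB => //; exact: mX.
exact: mi.
Qed.

Lemma measurable_dotprod (d : measure_display) (T : measurableType d)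
    (R : realType) (n : nat) (X Y : T -> borel_rV R n) :
  measurable_fun setT X -> measurable_fun setT Y ->
  measurable_fun setT (fun w => dotprod (X w) (Y w)).
Proof.
move=> mX mY; apply: measurable_sum => i; apply: measurable_funM.
  exact: (measurableT_comp (measurable_rV_coord i) mX).
exact: (measurableT_comp (measurable_rV_coord i) mY).
Qed.

Lemma measurable_sphere (R : realType) (n : nat) :
  measurable (@sphere R n : set (borel_rV R n)).
Proof.
have -> : @sphere R n = (fun v : borel_rV R n => dotprod v v) @^-1` [set 1].
  apply/seteqP; split => v /=; first exact: sphere_dotprod.
  by rewrite /sphere /= /enorm => ->; rewrite sqrtr1.
rewrite -[X in measurable X]setTI.
have : measurable_fun setT (fun v : borel_rV R n => dotprod v v).
  exact: measurable_dotprod.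
exact.
Qed.

(** Partial derivatives are pointwise limits of difference quotients along the
    steps [1 / (m + 1)], which are continuous functions of the point. *)
Lemma measurable_gradient (R : realType) (n : nat) (f : 'rV[R]_n -> R) :
  (forall x, differentiable f x) ->
  measurable_fun setT (gradient f : borel_rV R n -> borel_rV R n).
Proof.
move=> df; have cf : continuous f by move=> x; exact: differentiable_continuous.
apply: measurable_fun_rV => [|i]; first exact: measurableT.
have -> : (fun x => gradient f x 0 i) = (fun x => 'D_(delta_mx 0 i) f x).
  by apply/funext => x; rewrite mxE.
pose q (m : nat) (x : 'rV[R]_n) : R :=
  (harmonic m)^-1 * (f (harmonic m *: delta_mx 0 i + x) - f x).
apply: (@measurable_fun_cvg _ (borel_rV R n) R setT (fun m => q m)) => [m|x _].
  apply: measurable_funM; first exact: measurable_cst.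
  apply: measurable_funB; last exact: continuous_measurable_rV.
  pose s (y : 'rV[R]_n) := harmonic m *: delta_mx 0 i + y.
  apply: (@continuous_measurable_rV _ _ (f \o s)) => x.
  have cs : {for x, continuous s}.
    by apply: continuousD; [exact: cst_continuous | exact: id].
  by apply: continuous_comp => //; exact: cf.
have /cvgr_dnbhsP/(_ (@harmonic R)) : derivable f x (delta_mx 0 i).
  exact: diff_derivable.
rewrite /derive => /(_ _)/wrap[]; last exact: cvg_trans.
by split; [move=> m; rewrite gt_eqF // harmonic_gt0 | exact: cvg_harmonic].
Qed.

Lemma measurable_pursuit_step (R : realType) (n : nat)
    (LSapprox : 'rV[R]_n -> 'rV[R]_n -> R)
    (mLSapprox : measurable_oracle LSapprox) :
  measurable_fun
    ([set: borel_rV R n] `*` (@sphere R n : set (borel_rV R n)))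
    (fun p => p.1 + LSapprox p.1 p.2 *: p.2 : borel_rV R n).
Proof.
have mD : measurable
    ([set: borel_rV R n] `*` (@sphere R n : set (borel_rV R n))).
  by apply: measurableX => //; exact: measurable_sphere.
apply: measurable_fun_rV => // i; under eq_fun do rewrite !mxE.
have mi := @measurable_rV_coord R n i.
apply: measurable_funD.
  by apply: measurable_funTS; exact: (measurableT_comp mi measurable_fst).
apply: measurable_funM => //.
by apply: measurable_funTS; exact: (measurableT_comp mi measurable_snd).
Qed.

Lemma measurable_random_pursuit (d : measure_display) (T : measurableType d)
    (R : realType) (n : nat) (LSapprox : 'rV[R]_n -> 'rV[R]_n -> R)
    (mLSapprox : measurable_oracle LSapprox) (x0 : 'rV[R]_n)
    (u : nat -> T -> borel_rV R n) (um : forall k, measurable_fun setT (u k))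
    (su : forall k w, @sphere R n (u k w)) (k : nat) :
  measurable_fun setT
    (fun w => random_pursuit LSapprox x0 (fun j => u j w) k : borel_rV R n).
Proof.
elim: k => [|k IH] /=; first exact: measurable_cst.
apply: (@measurable_comp _ _ _ _ _ _ _ _ setT
  (fun w => (random_pursuit LSapprox x0 (fun j => u j w) k : borel_rV R n,
    u k w)) _ _ (measurable_pursuit_step mLSapprox)).
- by apply: measurableX => //; exact: measurable_sphere.
- by move=> _ [w _ <-]; split => //=.
- exact: measurable_fun_pair.
Qed.

(** * Independence of the current iterate and the next direction *)

(** Independence on rectangles extends to all measurable sets of the product,
    jointly with a further event [E].  Both sides are finite measures in [C], and
    they agree with the product of the scaled law of [X] and the law of [Y] on
    rectangles, which determines them. *)
Lemma joint_law_indep (d d1 d2 : measure_display) (T : measurableType d)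
    (T1 : measurableType d1) (T2 : measurableType d2) (R : realType)
    (P : probability T R) (X : {RV P >-> T1}) (Y : {RV P >-> T2})
    (E : set T) (mE : measurable E)
    (XYE : forall A B, measurable A -> measurable B ->
      P (X @^-1` A `&` Y @^-1` B `&` E)
      = (P (X @^-1` A) * P (Y @^-1` B) * P E)%E)
    (C : set (T1 * T2)) (mC : measurable C) :
  P ((fun w => (X w, Y w)) @^-1` C `&` E)
  = ((distribution P X \x distribution P Y) C * P E)%E.
Proof.
have mXY : measurable_fun setT (fun w => (X w, Y w)).
  exact: measurable_fun_pair.
pose XY : {RV P >-> (T1 * T2)%type} := mfun_Sub (mem_set mXY).
have PEf : P E \is a fin_num by exact: fin_num_measure.
pose p : {nonneg R} := NngNum (fine_ge0 (measure_ge0 P E)).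
have pE : (p%:num)%:E = P E by rewrite /= fineK.
pose m1 := mscale p (distribution P X).
have scaled A B : measurable A -> measurable B ->
    (m1 A * distribution P Y B = P (X @^-1` A) * P (Y @^-1` B) * P E)%E.
  by move=> mA mB; rewrite /m1 /mscale pE -muleA muleC.
pose m' := pushforward (mrestr P mE) XY.
pose m'' := mscale p (distribution P X \x distribution P Y)%E.
have <- : (m1 \x distribution P Y)%E C = P (XY @^-1` C `&` E).
  apply: (@product_measure_unique _ _ _ _ _ m1 _ m') => // A B mA mB.
  by rewrite scaled // -XYE.
rewrite muleC -pE; apply: (@product_measure_unique _ _ _ _ _ m1 _ m'') => //.
move=> A B mA mB; rewrite scaled // /m'' /mscale pE muleC.
by congr (_ * _)%E => //; exact: product_measure1E.
Qed.

(** The induction carries independence of the [k]-th iterate from every finite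
    family of later directions, not just from [u k]: in the step, [u k] joins the
    iterate while the others stay as the event [E]. *)
Lemma iterate_indep_future (d : measure_display) (T : measurableType d)
    (R : realType) (P : probability T R) (n : nat)
    (LSapprox : 'rV[R]_n -> 'rV[R]_n -> R)
    (mLSapprox : measurable_oracle LSapprox) (x0 : 'rV[R]_n)
    (u : nat -> {RV P >-> borel_rV R n})
    (su : forall k w, @sphere R n (u k w)) (iu : mutually_independent u)
    (k : nat) (B : set (borel_rV R n)) (J : seq nat)
    (A : nat -> set (borel_rV R n)) :
  measurable B -> uniq J -> (forall j, j \in J -> (k <= j)%N) ->
  (forall j, measurable (A j)) ->
  P ((fun w => random_pursuit LSapprox x0 (fun j => u j w) k) @^-1` B
     `&` \bigcap_(j in [set` J]) (u j @^-1` A j))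
  = (P ((fun w => random_pursuit LSapprox x0 (fun j => u j w) k) @^-1` B)
     * P (\bigcap_(j in [set` J]) (u j @^-1` A j)))%E.
Proof.
elim: k B J A => [|k IH] B J A mB uJ kJ mA.
  rewrite /=; have [x0B|x0B] := pselect (B x0).
    rewrite (_ : _ @^-1` B = setT); last by apply/seteqP; split.
    by rewrite setTI probability_setT mul1e.
  rewrite (_ : _ @^-1` B = set0); last by apply/seteqP; split.
  by rewrite set0I measure0 mul0e.
set x := fun w => random_pursuit LSapprox x0 (fun j => u j w) k.
have um j : measurable_fun setT (u j) by exact: measurable_funP.
have mx := measurable_random_pursuit mLSapprox x0 um su k.
pose X : {RV P >-> borel_rV R n} := mfun_Sub (mem_set mx).
set E := \bigcap_(j in _) _.
have mE : measurable E.
  apply: fin_bigcap_measurable => // j _.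
  by rewrite -[X in measurable X]setTI; exact: um.
have kNJ : k \notin J by apply/negP => /kJ; rewrite ltnn.
have joint A1 A2 : measurable A1 -> measurable A2 ->
    P (X @^-1` A1 `&` u k @^-1` A2 `&` E)
    = (P (X @^-1` A1) * P (u k @^-1` A2) * P E)%E.
  move=> mA1 mA2.
  pose A' j := if j == k then A2 else A j.
  have mA' j : measurable (A' j) by rewrite /A'; case: eqP.
  have A'E : \bigcap_(j in [set` k :: J]) (u j @^-1` A' j) = u k @^-1` A2 `&` E.
    apply/seteqP; split => w /=.
      move=> h; split; first by have := h k; rewrite /A' /= eqxx inE eqxx; apply.
      move=> j jJ; have := h j; rewrite /A' /= inE jJ orbT => /(_ isT).
      by case: eqP => // jk; move: kNJ; rewrite -jk jJ.
    move=> [h1 h2] j; rewrite /= inE /A' => /orP[/eqP ->|jJ]; first by rewrite eqxx.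
    by case: eqP => [->//|_]; exact: h2.
  have uJ' : uniq (k :: J) by rewrite /= kNJ.
  rewrite -setIA -A'E IH //.
    rewrite iu // big_cons {1}/A' eqxx -muleA; congr (_ * (_ * _))%E.
    rewrite /E iu //; apply: eq_big_seq => j jJ; rewrite /A'.
    by case: eqP => // jk; move: kNJ; rewrite -jk jJ.
  by move=> j; rewrite inE => /orP[/eqP ->//|/kJ]; exact: ltnW.
(* The step map is measurable only where the second component is a unit
   vector; this restriction is harmless since the directions take values there. *)
pose D := [set: borel_rV R n] `*` (@sphere R n : set (borel_rV R n)).
pose C := D `&`
  (fun p : borel_rV R n * borel_rV R n => p.1 + LSapprox p.1 p.2 *: p.2) @^-1` B.
have mC : measurable C.
  apply: (measurable_pursuit_step mLSapprox) => //.
  by apply: measurableX => //; exact: measurable_sphere.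
have -> : (fun w => random_pursuit LSapprox x0 (fun j => u j w) k.+1) @^-1` B
    = (fun w => (X w, u k w)) @^-1` C.
  by apply/seteqP; split => w /=; [move=> Bw; do 2 split => //=; exact: su | case].
rewrite (joint_law_indep mE joint mC); congr (_ * _)%E.
rewrite -[X in P X]setIT (joint_law_indep measurableT _ mC).
  by rewrite probability_setT mule1.
move=> A1 A2 mA1 mA2; rewrite probability_setT mule1 setIT.
have := IH A1 [:: k] (fun=> A2).
rewrite set_cons1 bigcap_set1; apply=> // j.
by rewrite mem_seq1 => /eqP ->.
Qed.

(** * Second moments of the uniform distribution on the sphere *)

Lemma integral_orthogonal_invariant (R : realType) (n : nat)
    (m : probability (borel_rV R n) R) (hm : uniform_on_sphere m)
    (Q : 'M[R]_n) (h : borel_rV R n -> \bar R) :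
  Q *m Q^T = 1%:M -> measurable_fun setT h -> (forall v, 0 <= h v)%E ->
  (\int[m]_v h (v *m Q) = \int[m]_v h v)%E.
Proof.
move=> QQ mh h0.
have mQ : measurable_fun setT (fun v : borel_rV R n => v *m Q : borel_rV R n).
  apply: measurable_fun_rV => [|i]; first exact: measurableT.
  under eq_fun do rewrite mxE; apply: measurable_sum => j.
  by apply: measurable_funM => //; exact: measurable_rV_coord.
have := ge0_integral_pushforward mQ m measurableT mh (fun v _ => h0 v).
rewrite preimage_setT => <-.
by apply: eq_measure_integral => A mA _; case: hm => _; exact.
Qed.

Lemma dotprod_mulmx (R : realType) (n : nat) (x y : 'rV[R]_n) :
  x *m y^T = (dotprod x y)%:M.
Proof.
by apply/matrixP => i j; rewrite !ord1 !mxE eqxx; apply: eq_bigr => k _; rewrite mxE.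
Qed.

Lemma dotprod_mulmxr (R : realType) (n : nat) (Q : 'M[R]_n) (x y : 'rV[R]_n) :
  dotprod x (y *m Q) = dotprod (x *m Q^T) y.
Proof.
have : (dotprod x (y *m Q))%:M = (dotprod (x *m Q^T) y)%:M :> 'M[R]_1.
  by rewrite -!dotprod_mulmx trmx_mul mulmxA.
by move=> /matrixP/(_ 0 0); rewrite !mxE eqxx.
Qed.

Lemma dotprod_delta (R : realType) (n : nat) (i : 'I_n) (v : 'rV[R]_n) :
  dotprod (delta_mx 0 i) v = v 0 i.
Proof.
rewrite /dotprod (bigD1 i) //= big1 => [|j ji]; rewrite mxE /= ?eqxx.
  by rewrite addr0 mul1r.
by rewrite (negbTE ji) mul0r.
Qed.

(** The orthogonal map is the Householder reflection in the hyperplane orthogonal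
    to [x - y]. *)
Lemma orthogonal_transitive (R : realType) (n : nat) (x y : 'rV[R]_n) :
  dotprod x x = dotprod y y ->
  exists Q : 'M[R]_n, Q *m Q^T = 1%:M /\ x *m Q^T = y.
Proof.
move=> xy; have [->|/eqP xNy] := eqVneq x y.
  by exists 1%:M; rewrite trmx1 !mulmx1.
set w := x - y; set s := dotprod w w.
have s0 : s != 0.
  apply/eqP => s0; apply: xNy; apply/eqP; rewrite -subr_eq0; apply/eqP/rowP => i.
  rewrite [RHS]mxE -/w; have /eqP := s0.
  rewrite /s psumr_eq0 => [|j _]; last by rewrite -expr2 sqr_ge0.
  by move=> /allP /(_ i (mem_index_enum _)); rewrite mulf_eq0 orbb => /eqP.
have xw : 2 * dotprod x w = s.
  rewrite /s /w -scaleN1r !dotprodDr !dotprodDl !dotprodZr !dotprodZl xy.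
  by rewrite (dotprodC y x); ring.
pose Q : 'M[R]_n := 1%:M - (2 / s) *: (w^T *m w).
have QT : Q^T = Q.
  by rewrite /Q linearB linearZ /= trmx1 trmx_mul trmxK.
exists Q; rewrite QT; split.
  rewrite /Q mulmxBr mulmx1 mulmxBl mul1mx -scalemxAl -scalemxAr mulmxA.
  rewrite -(mulmxA w^T w w^T) dotprod_mulmx -/s mul_mx_scalar -scalemxAl !scalerA.
  have -> : 2 / s * (2 / s * s) = 2 / s + 2 / s by field.
  by rewrite scalerDl; move: (_ *: _) => V; apply/matrixP => i j; rewrite !mxE; ring.
rewrite /Q mulmxBr mulmx1 -scalemxAr mulmxA dotprod_mulmx mul_scalar_mx scalerA.
have -> : 2 / s * dotprod x w = 1 by rewrite mulrAC xw divff.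
by rewrite scale1r /w opprB addrC subrK.
Qed.

Lemma measurable_sqr_dotprod (R : realType) (n : nat) (x : 'rV[R]_n) :
  measurable_fun setT (fun v : borel_rV R n => (dotprod x v ^+ 2)%:E).
Proof.
apply/measurable_EFinP; apply: measurable_funX.
exact: (@measurable_dotprod _ (borel_rV R n) R n (cst x) id).
Qed.

(** By rotation invariance the second moment [J x] of [<x, v>] depends only on the
    norm of [x], so [J x = dotprod x x * J (e i)] for each basis vector [e i];
    and the [J (e i)] add up to the integral of [dotprod v v], which is [1].
    Moving all of [x] onto one axis means that only integrals of nonnegative
    functions occur, and no mixed moments. *)
Lemma uniform_second_moment (R : realType) (n : nat)
    (m : probability (borel_rV R n) R) (hm : uniform_on_sphere m)
    (x : 'rV[R]_n) :
  (n%:R%:E * \int[m]_v (dotprod x v ^+ 2)%:E = (dotprod x x)%:E)%E.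
Proof.
pose J (y : 'rV[R]_n) := (\int[m]_v (dotprod y v ^+ 2)%:E)%E.
have J_isotropic y z : dotprod y y = dotprod z z -> J y = J z.
  move=> /orthogonal_transitive[Q [QQ yQ]].
  rewrite /J -(integral_orthogonal_invariant hm QQ) //; last first.
  - by move=> v; rewrite lee_fin sqr_ge0.
  - exact: measurable_sqr_dotprod.
  by apply: eq_integral => v _; rewrite dotprod_mulmxr yQ.
pose e (i : 'I_n) : 'rV[R]_n := delta_mx 0 i.
have J_coord i : J x = ((dotprod x x)%:E * J (e i))%E.
  rewrite (J_isotropic x (enorm x *: e i)); last first.
    rewrite dotprodZl dotprodZr mulrA -expr2 enorm_sqr dotprod_delta.
    by rewrite mxE !eqxx mulr1.
  rewrite /J -ge0_integralZl //.
  - apply: eq_integral => v _.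
    by rewrite dotprodZl exprMn enorm_sqr EFinM.
  - exact: measurable_sqr_dotprod.
  - by move=> v _; rewrite lee_fin sqr_ge0.
  - by rewrite lee_fin dotprod_ge0.
have sumJ : (\sum_(i < n) J (e i) = 1)%E.
  rewrite /J -ge0_integral_sum //; last 2 first.
  - by move=> i; exact: measurable_sqr_dotprod.
  - by move=> i v _; rewrite lee_fin sqr_ge0.
  rewrite (ae_eq_integral (cst 1%E)) //.
  - exact: etrans (integral_cst m measurableT 1%E) (etrans (mul1e _) (probability_setT m)).
  - by apply: emeasurable_sum => i; exact: measurable_sqr_dotprod.
  - have ms := @measurable_sphere R n.
    exists (~` @sphere R n); split; first exact: measurableC.
      by apply: etrans (probability_setC m ms) _; rewrite [X in (1 - X)%E]hm.1 subee.
    move=> v /=; apply: contra_not => vs _.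
    rewrite sumEFin /=; congr EFin; rewrite -(sphere_dotprod vs).
    by apply: eq_bigr => i _; rewrite dotprod_delta expr2.
rewrite -/(J x) -[RHS]mule1 -sumJ ge0_sume_distrr; last first.
  by move=> i _; apply: integral_ge0 => v _; rewrite lee_fin sqr_ge0.
under eq_bigr do rewrite -J_coord.
by rewrite sumr_const card_ord; exact: mule_natl.
Qed.

(** * The expected decrease of one iteration *)

(** Conditionally on [X], the direction [U] is still uniform, so [n] times the
    squared slope of [g X] along [U] averages to the squared norm of [g X]. *)
Lemma integral_sqr_dotprod_indep (d : measure_display) (T : measurableType d)
    (R : realType) (P : probability T R) (n : nat)
    (X U : {RV P >-> borel_rV R n}) (g : borel_rV R n -> borel_rV R n) :
  measurable_fun setT g -> uniform_on_sphere (distribution P U) ->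
  (forall A B, measurable A -> measurable B ->
    P (X @^-1` A `&` U @^-1` B) = (P (X @^-1` A) * P (U @^-1` B))%E) ->
  (n%:R%:E * \int[P]_w (dotprod (g (X w)) (U w) ^+ 2)%:E
   = \int[P]_w (dotprod (g (X w)) (g (X w)))%:E)%E.
Proof.
move=> mg unifU indep.
have mXU : measurable_fun setT (fun w => (X w, U w)).
  exact: measurable_fun_pair.
pose XU : {RV P >-> (borel_rV R n * borel_rV R n)%type} :=
  mfun_Sub (mem_set mXU).
pose phi (p : borel_rV R n * borel_rV R n) : \bar R :=
  (dotprod (g p.1) p.2 ^+ 2)%:E.
have mphi : measurable_fun setT phi.
  apply/measurable_EFinP/measurable_funX/measurable_dotprod => //.
  exact: (measurableT_comp mg measurable_fst).
have phi0 p : (0 <= phi p)%E by rewrite lee_fin sqr_ge0.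
have mgg : measurable_fun setT (fun x => (dotprod (g x) (g x))%:E).
  by apply/measurable_EFinP/measurable_dotprod.
have gg0 x : (0 <= (dotprod (g x) (g x))%:E)%E by rewrite lee_fin dotprod_ge0.
have -> : (\int[P]_w (dotprod (g (X w)) (U w) ^+ 2)%:E
    = \int[distribution P XU]_p phi p)%E.
  by rewrite ge0_integral_distribution.
have -> : (\int[distribution P XU]_p phi p
    = \int[distribution P X \x distribution P U]_p phi p)%E.
  apply: eq_measure_integral => C mC _.
  have := @joint_law_indep _ _ _ _ _ _ _ P X U setT measurableT _ C mC.
  rewrite probability_setT mule1 setIT; apply => A B mA mB.
  by rewrite setIT mule1 indep.
rewrite (fubini_tonelli1 phi mphi phi0) /= -ge0_integralZl //; last 2 first.
- exact: measurable_fun_fubini_tonelli_F.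
- by move=> x _; apply: integral_ge0.
transitivity (\int[distribution P X]_x (dotprod (g x) (g x))%:E)%E.
  by apply: eq_integral => x _; exact: (uniform_second_moment unifU (g x)).
by rewrite ge0_integral_distribution.
Qed.

Lemma measurable_lin2 (d : measure_display) (T : measurableType d)
    (R : realType) (h1 h2 : T -> R) (b1 b2 : R) :
  measurable_fun setT h1 -> measurable_fun setT h2 ->
  measurable_fun setT (fun w => (b1 * h1 w + b2 * h2 w)%:E).
Proof.
move=> mh1 mh2; apply/measurable_EFinP/measurable_funD.
  by apply: measurable_funM => //; exact: measurable_cst.
by apply: measurable_funM => //; exact: measurable_cst.
Qed.

Lemma ge0_integral_scale (d : measure_display) (T : measurableType d)
    (R : realType) (P : {measure set T -> \bar R}) (h : T -> R) (b : R) :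
  measurable_fun setT h -> (forall w, 0 <= h w) -> 0 <= b ->
  (\int[P]_w (b * h w)%:E = b%:E * \int[P]_w (h w)%:E)%E.
Proof.
move=> mh h0 b0; rewrite -ge0_integralZl //.
  exact/measurable_EFinP.
by move=> w _; rewrite lee_fin.
Qed.

Lemma ge0_integral_lin2 (d : measure_display) (T : measurableType d)
    (R : realType) (P : {measure set T -> \bar R}) (h1 h2 : T -> R) (b1 b2 : R) :
  measurable_fun setT h1 -> measurable_fun setT h2 ->
  (forall w, 0 <= h1 w) -> (forall w, 0 <= h2 w) -> 0 <= b1 -> 0 <= b2 ->
  (\int[P]_w (b1 * h1 w + b2 * h2 w)%:E
   = b1%:E * \int[P]_w (h1 w)%:E + b2%:E * \int[P]_w (h2 w)%:E)%E.
Proof.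
move=> mh1 mh2 h10 h20 b10 b20.
rewrite -!ge0_integral_scale // -ge0_integralD //.
- by move=> w _; rewrite lee_fin mulr_ge0.
- by apply/measurable_EFinP; exact: measurable_funM.
- by move=> w _; rewrite lee_fin mulr_ge0.
- by apply/measurable_EFinP; exact: measurable_funM.
Qed.

Lemma probability_integral_cst (d : measure_display) (T : measurableType d)
    (R : realType) (P : probability T R) (b : R) : (\int[P]_w b%:E = b%:E)%E.
Proof. by have := expectation_cst P b; rewrite unlock. Qed.

Lemma ge0_bounded_integral_fin_num (d : measure_display) (T : measurableType d)
    (R : realType) (P : probability T R) (h : T -> R) (b : R) :
  measurable_fun setT h -> (forall w, 0 <= h w <= b) ->
  (\int[P]_w (h w)%:E)%E \is a fin_num.
Proof.
move=> mh h0b; have h0 w : 0 <= h w by case/andP: (h0b w).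
rewrite ge0_fin_numE; last by apply: integral_ge0 => w _; rewrite lee_fin.
apply: (@le_lt_trans _ _ (\int[P]_w (cst b%:E w))%E).
  apply: ge0_le_integral => //.
  - by move=> w _; rewrite lee_fin.
  - exact/measurable_EFinP.
  - by move=> w _; rewrite lee_fin; case/andP: (h0b w).
by rewrite probability_integral_cst ltry.
Qed.

(** Writing [delta k] for the expected gap, the descent step gives
    [delta k.+1 + E <g, u> ^ 2 / (2 L1) <= delta k + e], and
    [n E <g, u> ^ 2 = E |g| ^ 2].  The gap never exceeds its initial value by more
    than [k e], so the gap minus [k e] is an admissible [s] in
    [level_set_gradient_lb], which bounds [E |g| ^ 2] from below. *)
Lemma expected_step (R : realType) (n : nat) (L1 : R) (hL1 : 0 < L1)
    (f : 'rV[R]_n -> R) (hf : smooth_convex L1 f)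
    (xs : 'rV[R]_n) (hxs : forall y, f xs <= f y)
    (mu : R) (LS LSapprox : 'rV[R]_n -> 'rV[R]_n -> R)
    (hLS : exact_line_search f LS)
    (hLSapprox : abs_approx_line_search mu LS LSapprox)
    (mLSapprox : measurable_oracle LSapprox)
    (d : measure_display) (T : measurableType d) (P : probability T R)
    (u : nat -> {RV P >-> borel_rV R n}) (hu : uniform_directions u)
    (x0 : 'rV[R]_n)
    (r : R) (hr : forall y, f y <= f x0 -> enorm (y - xs) < r) :
  let x (k : nat) (w : T) := random_pursuit LSapprox x0 (fun j => u j w) k in
  let e := L1 * mu ^+ 2 / 2 in
  exists2 delta : nat -> R,
    forall k, (\int[P]_w (f (x k w) - f xs)%:E)%E = (delta k)%:E &
    delta 0%N = f x0 - f xs /\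
    forall k c, 0 <= c ->
      2 * c * (delta k - k%:R * e) - c ^+ 2
      <= 2 * n%:R * L1 * r ^+ 2 * (delta k + e - delta k.+1).
Proof.
move=> x e; case: hu => su unifu iu.
have e0 : 0 <= e by rewrite divr_ge0 // mulr_ge0 ?sqr_ge0 // ltW.
have [df _ _] := hf; have cf : continuous f.
  by move=> y; exact: differentiable_continuous.
pose D k w := f (x k w) - f xs.
have D0 k w : 0 <= D k w by rewrite subr_ge0.
pose q k w := dotprod (gradient f (x k w)) (u k w) ^+ 2.
have q0 k w : 0 <= q k w by rewrite sqr_ge0.
have L2V : 0 <= (2 * L1)^-1 by rewrite invr_ge0; lra.
have step k w : D k.+1 w + (2 * L1)^-1 * q k w <= D k w + e.
  have := descent_step hL1 hf hLS hLSapprox (x k w) (su k w).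
  rewrite -/e /D /q /= -/(x k w) [_ / (2 * L1)]mulrC; lra.
have Dub k w : D k w <= f x0 - f xs + k%:R * e.
  elim: k => [|k IH]; first by rewrite mul0r addr0.
  have : 0 <= (2 * L1)^-1 * q k w by rewrite mulr_ge0.
  have := step k w; rewrite -natr1; lra.
have um k : measurable_fun setT (u k) by exact: measurable_funP.
have mx k := measurable_random_pursuit mLSapprox x0 um su k.
have mD k : measurable_fun setT (D k).
  apply: measurable_funB => //.
  exact: (measurableT_comp (continuous_measurable_rV cf) (mx k)).
have mg := measurable_gradient df.
have mgx k := measurableT_comp mg (mx k).
have mq k : measurable_fun setT (q k).
  by apply/measurable_funX/measurable_dotprod => //; exact: mgx.
pose G k w := dotprod (gradient f (x k w)) (gradient f (x k w)).
have G0 k w : 0 <= G k w by exact: dotprod_ge0.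
have mG k : measurable_fun setT (G k).
  by apply: measurable_dotprod; exact: mgx.
have qG k : (n%:R%:E * \int[P]_w (q k w)%:E = \int[P]_w (G k w)%:E)%E.
  pose X : {RV P >-> borel_rV R n} := mfun_Sub (mem_set (mx k)).
  apply: (@integral_sqr_dotprod_indep _ _ _ P n X (u k) _ mg) => // A B mA mB.
  have := iterate_indep_future mLSapprox x0 su iu mA (J := [:: k]) (A := fun=> B).
  rewrite set_cons1 bigcap_set1 => /(_ k isT); apply => // j.
  by rewrite mem_seq1 => /eqP ->.
have ED_fin k : (\int[P]_w (D k w)%:E)%E \is a fin_num.
  apply: (@ge0_bounded_integral_fin_num _ _ _ _ _ (f x0 - f xs + k%:R * e)) => //.
  by move=> w; rewrite D0 Dub.
have Eq_fin k : (\int[P]_w (q k w)%:E)%E \is a fin_num.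
  apply: (@ge0_bounded_integral_fin_num _ _ _ _ _
    (2 * L1 * (f x0 - f xs + k%:R * e + e))) => // w; rewrite q0 /=.
  have L2 : 0 < 2 * L1 by lra.
  rewrite -ler_pdivrMl //; have := step k w; have := Dub k w; have := D0 k.+1 w.
  lra.
exists (fun k => fine (\int[P]_w (D k w)%:E)%E) => [k|]; first by rewrite fineK.
split.
  by rewrite /D /x /= probability_integral_cst.
move=> k c c0.
have i1 : (\int[P]_w (1 * D k.+1 w + (2 * L1)^-1 * q k w)%:E
    <= \int[P]_w (1 * D k w + e * 1)%:E)%E.
  apply: ge0_le_integral => //.
  - move=> w _; rewrite lee_fin mul1r; apply: addr_ge0; first exact: D0.
    by apply: mulr_ge0; [exact: L2V | exact: q0].
  - exact: (measurable_lin2 1 _ (mD k.+1) (mq k)).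
  - exact: (measurable_lin2 1 e (mD k) (@measurable_cst _ _ _ _ setT (1 : R))).
  - by move=> w _; rewrite lee_fin !mul1r mulr1.
rewrite !ge0_integral_lin2 // in i1.
have i2 : (\int[P]_w (2 * c * D k w)%:E
    <= \int[P]_w (r ^+ 2 * G k w + (c ^+ 2 + 2 * c * (k%:R * e)) * 1)%:E)%E.
  apply: ge0_le_integral => //.
  - by move=> w _; rewrite lee_fin !mulr_ge0 ?D0.
  - by apply/measurable_EFinP/measurable_funM => //; exact: measurable_cst.
  - exact: (measurable_lin2 _ _ (mG k) (@measurable_cst _ _ _ _ setT (1 : R))).
  - move=> w _; rewrite lee_fin mulr1.
    have ke : 0 <= k%:R * e by rewrite mulr_ge0.
    have hr' y : f y <= f xs + (f x0 - f xs) -> enorm (y - xs) < r.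
      by rewrite addrC subrK; exact: hr.
    have a0 : 0 <= f x0 - f xs by rewrite subr_ge0.
    have sa : D k w - k%:R * e <= f x0 - f xs by rewrite lerBlDr Dub.
    have sD : D k w - k%:R * e <= D k w by rewrite gerBl.
    have := level_set_gradient_lb hL1 hf hxs hr' a0 sa sD c0.
    rewrite -/(G k w); lra.
have c20 : 0 <= 2 * c by rewrite mulr_ge0.
have b0 : 0 <= c ^+ 2 + 2 * c * (k%:R * e).
  by apply: addr_ge0; [exact: sqr_ge0 | apply: mulr_ge0 => //; exact: mulr_ge0].
rewrite ge0_integral_scale // ge0_integral_lin2 ?sqr_ge0 // in i2.
move: (ED_fin k) (ED_fin k.+1) (Eq_fin k) i1 i2.
rewrite -qG !probability_integral_cst.
move: (\int[P]_w (D k w)%:E)%E (\int[P]_w (D k.+1 w)%:E)%E.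
move: (\int[P]_w (q k w)%:E)%E => [g| |] [d1| |] [d2| |] //= _ _ _.
rewrite -!EFinM -!EFinD !lee_fin => i1 i2.
have gub : g <= 2 * L1 * (d1 + e - d2).
  by rewrite -ler_pdivrMl; lra.
have : r ^+ 2 * (n%:R * g) <= r ^+ 2 * (n%:R * (2 * L1 * (d1 + e - d2))).
  by rewrite !ler_wpM2l // sqr_ge0.
lra.
Qed.

(** * The recursion and the theorem *)

(** The right-hand side is free in [c >= 0]; taking [c = Q' / (k + 2)] multiplies [s k] by
    the nonnegative factor [k / (k + 2)], so the inductive bound can be inserted
    whatever the sign of [s k]. *)
Lemma recursion_bound (R : realType) (Q' Q : R) (s : nat -> R) :
  0 < Q' -> Q' <= Q -> s 0%N <= Q ->
  (forall k c, 0 <= c -> s k.+1 <= s k - (2 * c * s k - c ^+ 2) / Q') ->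
  forall N, s N <= Q / (N%:R + 1).
Proof.
move=> Q'0 Q'Q s0 step; elim => [|k IH]; first by rewrite add0r divr1.
have K0 : 0 <= k%:R :> R by [].
rewrite -natr1; move: (k%:R) K0 IH => K K0 IH.
have c0 : 0 <= Q' / (K + 2) by rewrite divr_ge0 //; lra.
have := step k _ c0.
rewrite (_ : _ - _ = s k * (K / (K + 2)) + Q' / (K + 2) ^+ 2); last first.
  by field; rewrite !gt_eqF //; lra.
move=> h; apply: le_trans h _.
have K2 : 0 <= K / (K + 2) by rewrite divr_ge0 //; lra.
have h1 : s k * (K / (K + 2)) <= Q / (K + 1) * (K / (K + 2)).
  exact: ler_wpM2r.
have h2 : Q' / (K + 2) ^+ 2 <= Q / (K + 2) ^+ 2.
  by rewrite ler_pM2r // invr_gt0 exprn_gt0 //; lra.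
have h3 : Q / (K + 1 + 1) - (Q / (K + 1) * (K / (K + 2)) + Q / (K + 2) ^+ 2)
    = Q / ((K + 1) * (K + 2) ^+ 2).
  by field; rewrite !gt_eqF //; lra.
have : 0 <= Q / ((K + 1) * (K + 2) ^+ 2).
  by rewrite divr_ge0 // ?mulr_ge0 ?sqr_ge0 //; lra.
lra.
Qed.

Unset Implicit Arguments.

Theorem theorem5p3 (R : realType) (n : nat) (L1 : R) (hL1 : 0 < L1)
    (f : 'rV[R]_n -> R) (hf : smooth_convex L1 f)
    (xs : 'rV[R]_n) (hxs : forall y, f xs <= f y)
    (mu : R) (hmu : 0 <= mu)
    (LS LSapprox : 'rV[R]_n -> 'rV[R]_n -> R)
    (hLS : exact_line_search f LS)
    (hLSapprox : abs_approx_line_search mu LS LSapprox)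
    (mLS : measurable_oracle LS) (mLSapprox : measurable_oracle LSapprox)
    (d : measure_display) (T : measurableType d) (P : probability T R)
    (u : nat -> {RV P >-> borel_rV R n}) (hu : uniform_directions u)
    (x0 : 'rV[R]_n)
    (r : R) (hr : forall y, f y <= f x0 -> enorm (y - xs) < r)
    (N : nat) :
  let x (k : nat) (w : T) := random_pursuit LSapprox x0 (fun j => u j w) k in
  let Q := Num.max (2 * n%:R * L1 * r ^+ 2) (f x0 - f xs) in
  ('E_P[fun w => (f (x N w) - f xs)%R]
     <= (Q / (N%:R + 1) + N%:R * L1 * mu ^+ 2 / 2)%:E)%E.
Proof.
cbv zeta; set Q := Num.max _ _.
have [delta deltaE [delta0 step]] :=
  expected_step hL1 hf hxs hLS hLSapprox mLSapprox hu hr.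
(* In dimension 0 the sphere is empty, so no direction could be drawn. *)
have n0 : 0 < n%:R :> R.
  rewrite ltr0n lt0n; apply/eqP => n0; have [su _ _] := hu.
  have T0 : [set: T] = set0.
    apply/seteqP; split => // w _; have := sphere_dotprod (su 0%N w).
    rewrite /dotprod big1 => [/eqP|[i ilt] _]; first by rewrite eq_sym oner_eq0.
    by exfalso; move: ilt; rewrite n0.
  by have := probability_setT P; rewrite T0 measure0 => -[] /eqP; rewrite eq_sym oner_eq0.
have r0 : 0 < r by apply: le_lt_trans (hr x0 _) => //; exact: sqrtr_ge0.
pose s k := delta k - k%:R * (L1 * mu ^+ 2 / 2).
have Q'0 : 0 < 2 * n%:R * L1 * r ^+ 2 by rewrite !mulr_gt0 ?exprn_gt0.
have : s N <= Q / (N%:R + 1).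
  apply: (recursion_bound Q'0).
  - by rewrite le_max lexx.
  - by rewrite /s mul0r subr0 delta0 le_max lexx orbT.
  - move=> k c c0.
    have : (2 * c * s k - c ^+ 2) / (2 * n%:R * L1 * r ^+ 2)
        <= delta k + L1 * mu ^+ 2 / 2 - delta k.+1.
      by rewrite ler_pdivrMr // [leRHS]mulrC; exact: step.
    move: (_ / (2 * n%:R * _ * _)) => t; rewrite /s -natr1; lra.
rewrite /s unlock deltaE lee_fin; lra.
Qed.
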